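(* In the DS-Sync setting, assume: (i) $F$ is $L$-smooth; (ii) $F$ is $\mu$-strongly convex with minimizer $w^*$; (iii) $\mathbb{E}\,|\nabla F(w_t^k,\xi_t^k)-\nabla F(w_t^k)|^2\le\sigma^2$ for all $t,k$; (iv) $\mathbb{E}\,|\nabla F(w_t^k,\xi_t^k)|^2\le G^2$ for all $t,k$. Let $\kappa=L/\mu$, $\gamma=\max(8\kappa,2)$, and use learning rates $\eta_t=\frac{2}{\mu(\gamma+t)}$. For $t\ge0$ let $\bar w_t=\frac1N\sum_{k\in\mathcal{G}}w_t^k$, where $\mathcal{G}$ is any block of the partition $P_{t\bmod 2}$. Then for all $t\ge0$, $$\mathbb{E}[F(\bar w_t)]-F(w^* )\le\frac{2\kappa}{\gamma+t}\Big(\frac{B}{\mu}+2L\,|w_0-w^*|^2\Big),\qquad\text{where } B=\frac{\sigma^2}{N}+8G^2.$$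
   Context: DS-Sync setting. Let $N\ge1$ be an integer and $W=N^2$ workers indexed by $m\in\{0,\dots,W-1\}$. Two partitions of the workers into $N$ blocks of size $N$: $P_0$ with blocks $\{m:\lfloor m/N\rfloor=a\}$, and $P_1$ with blocks $\{m: m \bmod N=b\}$. For $s\ge0$ let $\mathcal{G}_s(m)$ denote the block of $P_{s \bmod 2}$ containing $m$. $F:\mathbb{R}^d\to\mathbb{R}$ is differentiable with stochastic gradient oracle $\nabla F(w,\xi)$. All workers start at $w_0^m=w_0$. For $t=0,1,2,\dots$, worker $m$ draws $\xi_t^m$, sets $v_{t+1}^m=w_t^m-\eta_t\nabla F(w_t^m,\xi_t^m)$, then $w_{t+1}^m=\frac1N\sum_{j\in\mathcal{G}_t(m)}v_{t+1}^j$. Let $\mathcal{F}_t$ be the $\sigma$-algebra generated by all $\xi_s^m$, $s<t$; conditionally on $\mathcal{F}_t$, the $\xi_t^m$ are independent across $m$, and $\mathbb{E}[\nabla F(w_t^m,\xi_t^m)\mid\mathcal{F}_t]=\nabla F(w_t^m)$. $L$-smooth: $F(v)\le F(w)+(v-w)^T\nabla F(w)+\frac L2|v-w|^2$ for all $v,w$. $\mu$-strongly convex: $F(v)\ge F(w)+(v-w)^T\nabla F(w)+\frac\mu2|v-w|^2$ for all $v,w$. $|\cdot|$ is the Euclidean norm. *)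

(* Defs.v *)
From HB Require Import structures.
From mathcomp Require Import all_boot all_order all_algebra.
From mathcomp Require Import all_classical all_reals all_analysis.
Set Implicit Arguments. Unset Strict Implicit. Unset Printing Implicit Defensive.
Import Order.TTheory GRing.Theory Num.Theory.
Import numFieldNormedType.Exports.
Local Open Scope classical_set_scope.
Local Open Scope ring_scope.

Definition dotp (R : realType) (d : nat) (u v : 'rV[R]_d) : R :=
  \sum_(i < d) u 0 i * v 0 i.
Definition sqn (R : realType) (d : nat) (v : 'rV[R]_d) : R := dotp v v.

Definition Lsmooth (R : realType) (d : nat) (F : 'rV[R]_d -> R)
  (gF : 'rV[R]_d -> 'rV[R]_d) (L : R) : Prop :=
  forall v w, F v <= F w + dotp (v - w) (gF w) + L / 2 * sqn (v - w).
Definition strongly_convex (R : realType) (d : nat) (F : 'rV[R]_d -> R)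
  (gF : 'rV[R]_d -> 'rV[R]_d) (mu : R) : Prop :=
  forall v w, F w + dotp (v - w) (gF w) + mu / 2 * sqn (v - w) <= F v.

Definition has_gradient (R : realType) (d : nat) (F : 'rV[R]_d -> R)
  (gF : 'rV[R]_d -> 'rV[R]_d) : Prop :=
  forall w, differentiable F w /\ forall v, 'D_v F w = dotp (gF w) v.

(* Workers m : 'I_(N*N).  same_block s j m  <->  j belongs to G_s(m), the block
   of P_(s mod 2) containing m.  P_0: same m/N ; P_1: same m mod N. *)
Definition same_block (N s : nat) (j m : 'I_(N * N)) : bool :=
  if odd s then (j %% N == m %% N)%N else (j %/ N == m %/ N)%N.

Fixpoint dsw (R : realType) (d N : nat) (Omega Xi : Type)
  (g : 'rV[R]_d -> Xi -> 'rV[R]_d) (eta : nat -> R) (w0 : 'rV[R]_d)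
  (xi : nat -> 'I_(N * N) -> Omega -> Xi) (t : nat) :
  'I_(N * N) -> Omega -> 'rV[R]_d :=
  match t with
  | 0 => fun _ _ => w0
  | s.+1 => fun m om =>
      (N%:R)^-1 *: \sum_(j : 'I_(N * N) | @same_block N s j m)
        (dsw g eta w0 xi s j om - eta s *: g (dsw g eta w0 xi s j om) (xi s j om))
  end.

Definition filt (d1 d2 : measure_display) (Omega : measurableType d1)
  (Xi : measurableType d2) (N : nat) (xi : nat -> 'I_(N * N) -> Omega -> Xi)
  (t : nat) : set (set Omega) :=
  <<s [set B | exists (s : nat) (m : 'I_(N * N)) (A : set Xi),
         (s < t)%N /\ measurable A /\ B = xi s m @^-1` A] >>.

Definition cond_exp_version (d1 : measure_display) (Omega : measurableType d1)
  (R : realType) (P : probability Omega R) (G : set (set Omega))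
  (X c : Omega -> R) : Prop :=
  (forall B : set R, measurable B -> G (c @^-1` B)) /\
  P.-integrable setT (EFin \o c) /\
  forall A, G A -> (\int[P]_(x in A) (X x)%:E = \int[P]_(x in A) (c x)%:E)%E.

Definition cond_indep (d1 d2 : measure_display) (Omega : measurableType d1)
  (Xi : measurableType d2) (R : realType) (P : probability Omega R)
  (I : finType) (G : set (set Omega)) (X : I -> Omega -> Xi) : Prop :=
  forall h : I -> Xi -> R,
    (forall m, measurable_fun setT (h m)) ->
    (forall m, exists M : R, forall x, `|h m x| <= M) ->
    exists c : I -> Omega -> R,
      (forall m, cond_exp_version P G (fun om => h m (X m om)) (c m)) /\
      forall A, G A ->
        (\int[P]_(x in A) (\prod_m h m (X m x))%:E
         = \int[P]_(x in A) (\prod_m c m x)%:E)%E.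

(* Main.v *)
Require Import Defs.
From HB Require Import structures.
From mathcomp Require Import all_boot all_order all_algebra.
From mathcomp Require Import all_classical all_reals all_analysis.
From mathcomp Require Import measurable_realfun ring lra.
Set Implicit Arguments. Unset Strict Implicit. Unset Printing Implicit Defensive.
Import Order.TTheory GRing.Theory Num.Theory.
Import numFieldNormedType.Exports.
Local Open Scope classical_set_scope.
Local Open Scope ring_scope.

(** A block of [P_(t mod 2)] meets every block of [P_((t-1) mod 2)] exactly once and
    the iterates [w_t^m] are constant on the latter, so the average over a block is
    the average over all the workers and follows the recursion
    [wbar_(t+1) = wbar_t - eta_t * mean_m g_t^m].  Smoothness and strong convexity
    at the points [w_t^m] give
    [<wbar_t - w*, mean_m gradF (w_t^m)> >=
       mu |wbar_t - w*|^2 - L/2 mean_m |w_t^m - wbar_t|^2],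
    and [E mean_m |w_(t+1)^m - wbar_(t+1)|^2 <= eta_t^2 G^2] because one averaging
    step brings all the workers back to [wbar_t] up to a block average of the
    gradients.  The resulting recursion on [E |wbar_t - w*|^2] gives the rate
    [1 / (gamma + t)]. *)

(** * Euclidean inner product, squared norm and the variance identity *)

Section dotp_theory.
Variables (R : realType) (d : nat).
Implicit Types (u v w : 'rV[R]_d) (a : R).

Lemma dotpC u v : dotp u v = dotp v u.
Proof. by apply: eq_bigr => i _; rewrite mulrC. Qed.

Lemma dotpDl u v w : dotp (u + v) w = dotp u w + dotp v w.
Proof. by rewrite -big_split; apply: eq_bigr => i _; rewrite mxE mulrDl. Qed.

Lemma dotpZl a u v : dotp (a *: u) v = a * dotp u v.
Proof. by rewrite mulr_sumr; apply: eq_bigr => i _; rewrite mxE mulrA. Qed.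

Lemma dotpNl u v : dotp (- u) v = - dotp u v.
Proof. by rewrite -scaleN1r dotpZl mulN1r. Qed.

Lemma dotpDr u v w : dotp w (u + v) = dotp w u + dotp w v.
Proof. by rewrite dotpC dotpDl !(dotpC _ w). Qed.

Lemma dotpZr a u v : dotp v (a *: u) = a * dotp v u.
Proof. by rewrite dotpC dotpZl (dotpC u). Qed.

Lemma dotpNr u v : dotp v (- u) = - dotp v u.
Proof. by rewrite dotpC dotpNl (dotpC u). Qed.

Lemma dotp_sumr I (r : seq I) (P : pred I) (f : I -> 'rV[R]_d) u :
  dotp u (\sum_(i <- r | P i) f i) = \sum_(i <- r | P i) dotp u (f i).
Proof.
elim/big_rec2: _ => [|i y z _ <-]; last by rewrite dotpDr.
by rewrite /dotp big1// => i _; rewrite mxE mulr0.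
Qed.

Lemma sqnE u : sqn u = dotp u u. Proof. by []. Qed.

Definition dotpE := (dotpDl, dotpDr, dotpNl, dotpNr, dotpZl, dotpZr).

Lemma sqn_ge0 u : 0 <= sqn u.
Proof. by apply: sumr_ge0 => i _; rewrite -expr2 sqr_ge0. Qed.

Lemma sqn0 : sqn (0 : 'rV[R]_d) = 0.
Proof. by rewrite /sqn /dotp big1// => i _; rewrite mxE mulr0. Qed.

Lemma sqn_eq0 u : sqn u = 0 -> u = 0.
Proof.
move=> u0; apply/rowP => i; rewrite mxE; apply/eqP.
have : [forall j : 'I_d, (true ==> (u 0 j * u 0 j == 0))].
  rewrite -big_andE; move/eqP: u0; rewrite /sqn /dotp psumr_eq0; last first.
    by move=> j _; rewrite -expr2 sqr_ge0.
  by rewrite -big_all.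
by move/forallP/(_ i) => /=; rewrite mulf_eq0 orbb.
Qed.

Lemma sqnZ a u : sqn (a *: u) = a ^+ 2 * sqn u.
Proof. by rewrite /sqn dotpZl dotpZr mulrA. Qed.

Lemma sqnN u : sqn (- u) = sqn u.
Proof. by rewrite /sqn dotpNl dotpNr opprK. Qed.

Lemma sqnB u v : sqn (u - v) = sqn u - 2 * dotp u v + sqn v.
Proof. by rewrite /sqn !dotpE (dotpC v u); lra. Qed.

Lemma sqr_coord_le u i : (u 0 i) ^+ 2 <= sqn u.
Proof.
rewrite /sqn /dotp (bigD1 i)//= -expr2 lerDl.
by apply: sumr_ge0 => j _; rewrite -expr2 sqr_ge0.
Qed.

(* Summing the identity [sqn f_i = sqn c + 2<c, f_i - c> + sqn (f_i - c)] around
   the mean [c] kills the cross terms. *)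
Lemma sqn_mean (I : finType) (P : pred I) (n : nat) (f : I -> 'rV[R]_d) :
  (0 < n)%N -> #|P| = n ->
  let c := n%:R^-1 *: \sum_(i | P i) f i in
  n%:R^-1 * \sum_(i | P i) sqn (f i - c) =
    n%:R^-1 * (\sum_(i | P i) sqn (f i)) - sqn c.
Proof.
move=> n0 Pn c.
have n0' : (n%:R : R) != 0 by rewrite pnatr_eq0 -lt0n.
under eq_bigr do rewrite sqnB.
rewrite big_split /= sumrB -mulr_sumr.
have -> : \sum_(i | P i) dotp (f i) c = n%:R * sqn c.
  under eq_bigr do rewrite dotpC.
  rewrite -dotp_sumr.
  have -> : \sum_(i | P i) f i = n%:R *: c by rewrite scalerA mulfV// scale1r.
  by rewrite dotpZr.
rewrite sumr_const Pn -mulr_natl; field.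
exact: n0'.
Qed.

(** Jensen's inequality for the squared norm: the variance in [sqn_mean] is nonnegative. *)
Lemma sqn_mean_le (I : finType) (P : pred I) (n : nat) (f : I -> 'rV[R]_d) :
  (0 < n)%N -> #|P| = n ->
  sqn (n%:R^-1 *: \sum_(i | P i) f i) <= n%:R^-1 * \sum_(i | P i) sqn (f i).
Proof.
move=> n0 Pn; rewrite -subr_ge0 -(sqn_mean _ n0 Pn).
by rewrite mulr_ge0// sumr_ge0// => i _; exact: sqn_ge0.
Qed.

End dotp_theory.

(** * Pointwise consequences of smoothness and strong convexity *)

Section smooth_convex.
Variables (R : realType) (d : nat) (F : 'rV[R]_d -> R) (gF : 'rV[R]_d -> 'rV[R]_d).
Variables (L mu : R) (wstar : 'rV[R]_d).
Hypotheses (L0 : 0 < L) (mu0 : 0 < mu).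
Hypotheses (smF : Lsmooth F gF L) (scF : strongly_convex F gF mu).
Hypothesis minF : forall w, F wstar <= F w.

(* One gradient step of length [1/L] decreases [F] by at least [|gF w|^2/(2L)]. *)
Lemma sqn_grad_le w : sqn (gF w) <= 2 * L * (F w - F wstar).
Proof.
have := smF (w - L^-1 *: gF w) w; rewrite [w - _ - w]addrAC subrr add0r => h.
have := le_trans (minF _) h; rewrite dotpNl dotpZl sqnN sqnZ -sqnE => h1.
have -> : sqn (gF w) =
    2 * L * (- (- (L^-1 * sqn (gF w)) + L / 2 * (L^-1 ^+ 2 * sqn (gF w)))).
  by field; rewrite gt_eqF.
rewrite ler_pM2l ?mulr_gt0//; lra.
Qed.

(** The gap in [sqn_grad_le] vanishes at [wstar]. *)
Lemma grad_min0 : gF wstar = 0.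
Proof.
apply: sqn_eq0; apply/eqP; rewrite eq_le sqn_ge0 andbT.
by rewrite (le_trans (sqn_grad_le _))// subrr mulr0.
Qed.

Lemma F_upper w : F w - F wstar <= L / 2 * sqn (w - wstar).
Proof.
have := smF w wstar; rewrite grad_min0 -(scale0r 0) dotpZr mul0r; lra.
Qed.

Lemma F_lower w : mu / 2 * sqn (w - wstar) <= F w - F wstar.
Proof.
have := scF w wstar; rewrite grad_min0 -(scale0r 0) dotpZr mul0r; lra.
Qed.

(** Chains the descent bound with the quadratic upper bound on the gap. It later shows that the true
    gradients along the iterates are square integrable. *)
Lemma sqn_grad_le_dist w : sqn (gF w) <= L ^+ 2 * sqn (w - wstar).
Proof.
apply: le_trans (sqn_grad_le _) _.
have := F_upper w; rewrite -(ler_pM2l (mulr_gt0 (@ltr0Sn R 1) L0)); lra.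
Qed.

(* If [L < mu] the space is trivial, the only case where [max (8 kappa) 2] may
   differ from [8 kappa]. *)
Lemma max_kappa_sqn w :
  Num.max (8 * (L / mu)) 2 * sqn (w - wstar) = 8 * (L / mu) * sqn (w - wstar).
Proof.
have [muL|Lmu] := leP mu L.
  rewrite max_l//.
  have : 1 <= L / mu by rewrite ler_pdivlMr// mul1r.
  lra.
(* When [L < mu], the lower bound [F_lower] exceeds the upper bound [F_upper] unless the distance is
   zero. *)
suff -> : sqn (w - wstar) = 0 by rewrite !mulr0.
apply/eqP; rewrite eq_le sqn_ge0 andbT.
have := le_trans (F_lower w) (F_upper w) => h.
rewrite -(@pmulr_rle0 _ ((mu - L) / 2)); last by rewrite divr_gt0// subr_gt0.
lra.
Qed.

(* Strong convexity between [x] and [wstar], smoothness between [x] and the average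
   [c]. *)
Lemma dotp_grad_ge c x :
  F c - F wstar + mu / 2 * sqn (x - wstar) - L / 2 * sqn (x - c)
  <= dotp (c - wstar) (gF x).
Proof.
have h1 := smF c x; have h2 := scF wstar x.
have -> : c - wstar = (c - x) - (wstar - x) by rewrite opprB addrA subrK.
rewrite dotpDl dotpNl.
rewrite -(opprB c x) -(opprB wstar x) !sqnN; lra.
Qed.

(** Average [dotp_grad_ge] over [i]. Half of the coefficient [mu] comes from the mean of
    [sqn (x i - wstar)] by Jensen, the other half from the gap [F c - F wstar] by strong
    convexity. *)
Lemma dotp_mean_grad_ge (I : finType) (n : nat) (x : I -> 'rV[R]_d) c :
  (0 < n)%N -> #|I| = n -> c = n%:R^-1 *: \sum_i x i ->
  mu * sqn (c - wstar) - L / 2 * (n%:R^-1 * \sum_i sqn (x i - c))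
  <= n%:R^-1 * \sum_i dotp (c - wstar) (gF (x i)).
Proof.
move=> n0 In cE.
have n0' : (0 : R) < n%:R^-1 by rewrite invr_gt0 ltr0n.
have nn : (n%:R^-1 * n%:R : R) = 1 by rewrite mulVf// pnatr_eq0 -lt0n.
apply: (@le_trans _ _ (n%:R^-1 * \sum_i
    (F c - F wstar + mu / 2 * sqn (x i - wstar) - L / 2 * sqn (x i - c)))); last first.
  by rewrite ler_pM2l//; apply: ler_sum => i _; exact: dotp_grad_ge.
rewrite sumrB big_split/= sumr_const In -!mulr_sumr.
set SA := \sum_i sqn (x i - wstar); set SB := \sum_i sqn (x i - c).
have -> : n%:R^-1 * ((F c - F wstar) *+ n + mu / 2 * SA - L / 2 * SB) =
    F c - F wstar + mu / 2 * (n%:R^-1 * SA) - L / 2 * (n%:R^-1 * SB).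
  by rewrite -mulr_natl; field; rewrite pnatr_eq0 -lt0n.
have : sqn (c - wstar) <= n%:R^-1 * SA.
  have := sqn_mean_le (fun i => x i - wstar) n0 In.
  rewrite sumrB sumr_const cardT -cardE In scalerBr -cE.
  by rewrite -[wstar *+ n]scaler_nat scalerA nn scale1r.
have := F_lower c.
move=> h1 h2.
have : mu / 2 * sqn (c - wstar) <= mu / 2 * (n%:R^-1 * SA).
  by rewrite ler_pM2l// divr_gt0.
lra.
Qed.

End smooth_convex.

(** * Combinatorics of the two crossing partitions *)

Section blocks.
Variables (N : nat).
Hypothesis N0 : (0 < N)%N.

Lemma worker_subproof (a b : 'I_N) : (a * N + b < N * N)%N.
Proof.
by rewrite (@leq_trans (a * N + N))// ?ltn_add2l// -mulSnr leq_mul2r ltn_ord orbT.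
Qed.

Definition worker_of (a b : 'I_N) : 'I_(N * N) := Ordinal (worker_subproof a b).

(* The worker in position [b] of block [a] of [P_(s mod 2)]. *)
Definition worker (s : nat) (a b : 'I_N) : 'I_(N * N) :=
  if odd s then worker_of b a else worker_of a b.

(** The workers form an [N] by [N] grid; a change of parity exchanges its rows and columns. All
    crossing arguments reduce to this. *)
Lemma workerS s a b : worker s.+1 a b = worker s b a.
Proof. by rewrite /worker /=; case: (odd s). Qed.

Lemma worker_divn a b : (worker_of a b %/ N)%N = a.
Proof. by rewrite /= divnMDl// divn_small ?addn0. Qed.

Lemma worker_modn a b : (worker_of a b %% N)%N = b.
Proof. by rewrite /= modnMDl modn_small. Qed.

Lemma same_block_worker s a b a' b' :
  same_block s (worker s a b) (worker s a' b') = (a == a').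
Proof.
by rewrite /same_block /worker; case: (odd s); rewrite ?worker_divn ?worker_modn.
Qed.

Lemma workerP s m : exists a b, m = worker s a b.
Proof.
have mq : (m %/ N < N)%N by rewrite ltn_divLR.
have mr : (m %% N < N)%N by rewrite ltn_mod.
have me : m = worker_of (Ordinal mq) (Ordinal mr).
  by apply: val_inj; rewrite /= -divn_eq.
by rewrite /worker; case: (odd s);
  [exists (Ordinal mr), (Ordinal mq)|exists (Ordinal mq), (Ordinal mr)].
Qed.

(** The block for [s] determines [a], the block for [s.+1] determines [b]: two crossing blocks share
    at most one worker. *)
Lemma worker_inj s a b a' b' : worker s a b = worker s a' b' -> a = a' /\ b = b'.
Proof.
move=> h; have := same_block_worker s a b a' b'.
have := same_block_worker s.+1 b a b' a'.
rewrite !workerS h -{1}(workerS s) -{1}(workerS s) !same_block_worker.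
by rewrite !eqxx => /esym/eqP ? /esym/eqP ?.
Qed.

Lemma same_block_sym s (j m : 'I_(N * N)) : same_block s j m = same_block s m j.
Proof. by rewrite /same_block; case: ifP => _; rewrite eq_sym. Qed.

Lemma same_block_eq s (j j' m : 'I_(N * N)) :
  same_block s j j' -> same_block s m j = same_block s m j'.
Proof. by rewrite /same_block; case: ifP => _ /eqP ->. Qed.

Section sums.
Variables (V : nmodType) (s : nat) (f : 'I_(N * N) -> V).

Lemma sum_workers : \sum_m f m = \sum_a \sum_b f (worker s a b).
Proof.
rewrite pair_big/= (reindex (fun p => worker s p.1 p.2))//=.
apply: onW_bij; apply: inj_card_bij => [[a b] [a' b'] /= /worker_inj[-> ->]//|].
by rewrite card_prod !card_ord.
Qed.

Lemma sum_block a b0 :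
  \sum_(m | same_block s m (worker s a b0)) f m = \sum_b f (worker s a b).
Proof.
rewrite [LHS]big_mkcond.
have reidx : {on [pred _ | true], bijective (fun p : 'I_N * 'I_N => worker s p.1 p.2)}.
  apply: onW_bij; apply: inj_card_bij => [[u v] [u' v'] /= /worker_inj[-> ->]//|].
  by rewrite card_prod !card_ord.
rewrite (reindex _ reidx) /= -(pair_big predT predT
  (fun i j => if same_block s (worker s i j) (worker s a b0)
              then f (worker s i j) else 0))/=.
rewrite (bigD1 a)//= [X in _ + X]big1 ?addr0 => [|i ia].
  by apply: eq_bigr => b _; rewrite same_block_worker eqxx.
by apply: big1 => b _; rewrite same_block_worker (negbTE ia).
Qed.

End sums.

Lemma card_block s (m : 'I_(N * N)) : #|[pred j | same_block s j m]| = N.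
Proof.
have [a [b ->]] := workerP s m.
by rewrite -sum1_card/= sum_block sum_nat_const card_ord muln1.
Qed.

(** Double counting: [f j] occurs once for each of the [N] workers in the block of [j]. *)
Lemma sum_blocks (V : nmodType) s (f : 'I_(N * N) -> V) :
  \sum_m \sum_(j | same_block s j m) f j = (\sum_j f j) *+ N.
Proof.
rewrite (exchange_big_dep predT)//= -sumrMnl; apply: eq_bigr => j _.
under eq_bigl do rewrite same_block_sym.
by rewrite sumr_const card_block.
Qed.

(** A block for [s.+1] contains one representative of each block for [s], and each representative
    stands for [N] equal values. *)
Lemma sum_cross_block (V : nmodType) s (f : 'I_(N * N) -> V) m0 :
  (forall m m', same_block s m m' -> f m = f m') ->
  (\sum_(m | same_block s.+1 m m0) f m) *+ N = \sum_m f m.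
Proof.
move=> fc; have [a0 [b0 ->]] := workerP s.+1 m0.
rewrite sum_block (sum_workers s) -sumrMnl; apply: eq_bigr => b _.
rewrite workerS -{1}(card_ord N) -sumr_const; apply: eq_bigr => i _.
by apply: fc; rewrite same_block_worker.
Qed.

End blocks.

(** * Integrable and square integrable random variables *)

Section square_integrable.
Import HBSimple HBNNSimple.
Local Open Scope ring_scope.
Context d (T : measurableType d) (R : realType) (P : probability T R).
Implicit Types f g : T -> R.

Definition L1 f := P.-integrable setT (EFin \o f).
(** Measurability is a separate clause because that of the square does not imply that of [f]. *)
Definition L2 f := measurable_fun setT f /\ L1 (fun x => f x ^+ 2).

Lemma L1_measurable f : L1 f -> measurable_fun setT f.
Proof. by move/(measurable_int P)/measurable_EFinP. Qed.

Lemma le_L1 f g : measurable_fun setT f -> L1 g ->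
  (forall x, `|f x| <= g x) -> L1 f.
Proof.
move=> mf ig fg; apply: le_integrable ig => //; first exact/measurable_EFinP.
by move=> x _ /=; rewrite lee_fin (le_trans (fg x))// ler_norm.
Qed.

Lemma L1_cst k : L1 (fun=> k).
Proof. exact: finite_measure_integrable_cst. Qed.

Lemma L1D f g : L1 f -> L1 g -> L1 (fun x => f x + g x).
Proof. by move=> f1 g1; exact: (integrableD measurableT f1 g1). Qed.

Lemma L1Z k f : L1 f -> L1 (fun x => k * f x).
Proof. by move=> f1; exact: (integrableZl measurableT k f1). Qed.

Lemma L1B f g : L1 f -> L1 g -> L1 (fun x => f x - g x).
Proof. by move=> f1 g1; exact: (integrableB measurableT f1 g1). Qed.

Lemma L1_sum (I : Type) (r : seq I) (p : pred I) (f : I -> T -> R) :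
  (forall i, L1 (f i)) -> L1 (fun x => \sum_(i <- r | p i) f i x).
Proof.
move=> fi; rewrite /L1 (_ : _ \o _ = fun x => (\sum_(i <- r | p i) (f i x)%:E)%E).
  by apply: (@integrable_sum _ T R P setT measurableT I r p) => i _; exact: fi.
by apply/funext => x /=; rewrite sumEFin.
Qed.

Lemma Rintegral_sum (I : Type) (r : seq I) (p : pred I) (f : I -> T -> R) :
  (forall i, L1 (f i)) ->
  \int[P]_x (\sum_(i <- r | p i) f i x) = \sum_(i <- r | p i) \int[P]_x f i x.
Proof.
move=> fi; elim: r => [|i r ih].
  rewrite big_nil; under eq_Rintegral do rewrite big_nil.
  by rewrite Rintegral_cst// mul0r.
rewrite big_cons; under eq_Rintegral do rewrite big_cons.
by case: ifP => _ //; rewrite RintegralD ?ih//; [exact: fi|exact: L1_sum].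
Qed.

(** Only integrability is wanted, so [|a b| <= a^2 + b^2] suffices as domination. *)
Lemma L2_mul f g : L2 f -> L2 g -> L1 (fun x => f x * g x).
Proof.
move=> [mf f2] [mg g2]; apply: le_L1 (L1D f2 g2) _; first exact: measurable_funM.
move=> x; rewrite normrM -(real_normK (num_real (f x))) -(real_normK (num_real (g x))).
move: `|f x| `|g x| => a b; have := sqr_ge0 (a - b); have := sqr_ge0 (a + b); lra.
Qed.

Lemma L2_L1 f : L2 f -> L1 f.
Proof.
move=> f2; have [mf _] := f2.
have c2 : L2 (fun=> 1) by split => //; exact: L1_cst.
by have := L2_mul f2 c2; under eq_fun do rewrite mulr1.
Qed.

Lemma L2_cst k : L2 (fun=> k).
Proof. by split => //; exact: L1_cst. Qed.

Lemma L2Z k f : L2 f -> L2 (fun x => k * f x).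
Proof.
move=> [mf f2]; split; first exact: measurable_funM.
by under eq_fun do rewrite exprMn; exact: L1Z.
Qed.

Lemma L2D f g : L2 f -> L2 g -> L2 (fun x => f x + g x).
Proof.
move=> f2 g2; have fg := L2_mul f2 g2.
case: f2 g2 => [mf f2] [mg g2]; split; first exact: measurable_funD.
under eq_fun do rewrite sqrrD.
by apply: L1D => //; apply: L1D => //; under eq_fun do rewrite -mulr_natl; exact: L1Z.
Qed.

Lemma L2B f g : L2 f -> L2 g -> L2 (fun x => f x - g x).
Proof.
move=> f2 g2; under eq_fun do rewrite -mulN1r.
by apply: L2D => //; exact: L2Z.
Qed.

Lemma L2_sum (I : Type) (r : seq I) (p : pred I) (f : I -> T -> R) :
  (forall i, L2 (f i)) -> L2 (fun x => \sum_(i <- r | p i) f i x).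
Proof.
move=> fi; elim: r => [|i r ih].
  by under eq_fun do rewrite big_nil; exact: L2_cst.
under eq_fun do rewrite big_cons.
by case: (p i) => //; exact: L2D.
Qed.

Lemma le_L2 f g : measurable_fun setT f -> L1 g ->
  (forall x, f x ^+ 2 <= g x) -> L2 f.
Proof.
move=> mf g1 fg; split => //; apply: le_L1 g1 _; first exact: measurable_funX.
by move=> x; rewrite ger0_norm ?sqr_ge0.
Qed.

(* "Taking out what is known", in the form [E[Y | C] = 0 -> E[X Y] = 0]. *)
Lemma Rintegral_mul0 (C : set (set T)) (X Y : T -> R) :
  (<<s C >> `<=` measurable) ->
  measurable_fun setT (X : g_sigma_algebraType C -> R) ->
  measurable_fun setT X ->
  L1 Y -> L1 (fun x => X x * Y x) ->
  (forall A, <<s C >> A -> \int[P]_(x in A) (Y x)%:E = 0)%E ->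
  \int[P]_x (X x * Y x) = 0.
Proof.
move=> Cm mX mX' Y1 XY1 Y0.
(* Reduction to nonnegative [X] through positive and negative parts; both products with [Y] stay
   dominated by [|X Y|]. *)
wlog X0 : X mX mX' XY1 / forall x, 0 <= X x => [wl|].
  have XpY1 : L1 (fun x => X^\+%R x * Y x).
    apply: le_L1 (integrable_norm XY1) _ => [|x].
      by apply: measurable_funM; [exact: measurable_funrpos|exact: L1_measurable].
    rewrite /= !normrM ler_wpM2r// ger0_norm ?le_max ?lexx ?orbT//.
    by rewrite /funrpos ge_max normr_ge0 ler_norm.
  have XnY1 : L1 (fun x => X^\-%R x * Y x).
    apply: le_L1 (integrable_norm XY1) _ => [|x].
      by apply: measurable_funM; [exact: measurable_funrneg|exact: L1_measurable].
    rewrite /= !normrM ler_wpM2r// ger0_norm ?le_max ?lexx ?orbT//.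
    by rewrite /funrneg ge_max normr_ge0 -normrN ler_norm.
  have hp : \int[P]_x (X^\+%R x * Y x) = 0.
    by apply: wl => //; [exact: measurable_funrpos mX|exact: measurable_funrpos mX'].
  have hn : \int[P]_x (X^\-%R x * Y x) = 0.
    by apply: wl => //; [exact: measurable_funrneg mX|exact: measurable_funrneg mX'].
  rewrite -[RHS](subrr 0) -{1}hp -hn -RintegralB//.
  apply: eq_Rintegral => x _; rewrite -mulrBl.
  by congr (_ * _); exact: (esym (congr1 (@^~ x) (funrposBneg X))).
have mXE : measurable_fun setT (EFin \o X : g_sigma_algebraType C -> \bar R).
  exact/measurable_EFinP.
(* The approximation is taken in the measurable space generated by [C], so that the level sets of
   [S n] lie in [<<s C>>], where [Y] integrates to zero. *)
pose S := nnsfun_approx measurableT mXE.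
have S_le n x : S n x <= X x.
  rewrite -lee_fin /S nnsfun_approxE.
  by apply: le_approx => // y _; rewrite /= lee_fin.
have S_cvg x : (S n x)%:E @[n --> \oo] --> (X x)%:E.
  by apply: (@cvg_nnsfun_approx _ _ _ _ measurableT _ mXE) => // y _; rewrite /= lee_fin.
have mS' n : measurable_fun [set: g_sigma_algebraType C] (S n).
  exact: measurable_funP.
have S_meas n r : <<s C >> (S n @^-1` [set r]).
  have := mS' n measurableT _ (measurable_set1 r).
  by rewrite setTI.
have Y1A A : <<s C >> A -> L1 (fun x => Y x * \1_A x).
  move=> CA; apply: le_L1 (integrable_norm Y1) _ => [|x].
    apply: measurable_funM; first exact: L1_measurable.
    by apply: measurable_indic; exact: Cm.
  by rewrite /= normrM indicE; case: (_ \in _); rewrite ?normr1 ?normr0 ?mulr1 ?mulr0.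
have S_int n : (\int[P]_x (S n x * Y x)%:E = 0)%E.
  have S_sum x : (S n x * Y x)%:E = (\sum_(r <- finmap.enum_fset (fset_set (range (S n))))
      (r * (Y x * \1_(S n @^-1` [set r]) x))%:E)%E.
    rewrite sumEFin [in LHS](fimfunE (S n)) fsbig_finite//= mulr_suml.
    by congr EFin; apply: eq_bigr => r _; rewrite -mulrA (mulrC (Y x)).
  under eq_integral do rewrite S_sum.
  rewrite integral_sum// => [|r]; last by apply: L1Z; exact: Y1A.
  apply: big1 => r _.
  under eq_integral do rewrite EFinM.
  rewrite integralZl//; last exact: Y1A.
  rewrite -[X in (_ * X)%E](_ : \int[P]_(x in S n @^-1` [set r]) (Y x)%:E = _)%E.
    by rewrite Y0// mule0.
  rewrite [LHS]integral_mkcond; apply: eq_integral => x _.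
  by rewrite patchE indicE; case: (_ \in _); rewrite ?mulr1 ?mulr0.
have mS n : measurable_fun setT (S n : T -> R).
  move=> _ B mB; apply: Cm.
  exact: (mS' n measurableT _ mB).
have mY := L1_measurable Y1.
have mSY n : measurable_fun setT (fun x : T => (S n x * Y x)%:E).
  by apply/measurable_EFinP/measurable_funM.
have mXY : measurable_fun setT (fun x => (X x * Y x)%:E).
  by apply/measurable_EFinP/measurable_funM.
(* Dominated convergence with bound [|X Y|] carries the zero integrals of [S n * Y] to the limit. *)
have SYcvg : {ae P, forall x, setT x -> (S n x * Y x)%:E @[n --> \oo] --> (X x * Y x)%:E}.
  apply: aeW => x _.
  have defM : ((X x)%:E *? (Y x)%:E)%E by rewrite mule_def_fin.
  exact: (@cvgeM _ \oo _ _ _ _ _ _ defM (S_cvg x) (cvg_cst (Y x)%:E)).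
have SYle : {ae P, forall x n, setT x -> (`|(S n x * Y x)%:E| <= `|X x * Y x|%:E)%E}.
  apply: aeW => x n _ /=; rewrite lee_fin !normrM ler_wpM2r// !ger0_norm//.
have [_ _] := dominated_convergence measurableT mSY mXY SYcvg (integrable_norm XY1) SYle.
move=> /cvg_lim; rewrite /Rintegral => <-//.
rewrite (_ : [sequence _]_n = cst 0%E); last first.
  by apply/funext => n /=; rewrite S_int.
by rewrite lim_cst.
Qed.
End square_integrable.

(** * Measurability of the objective and of its gradient *)

Section smooth_convex_measurable.
Variables (R : realType) (d : nat) (F : 'rV[R]_d -> R) (gF : 'rV[R]_d -> 'rV[R]_d).
Variables (L mu : R).
Hypotheses (L0 : 0 < L) (mu0 : 0 < mu).
Hypotheses (smF : Lsmooth F gF L) (scF : strongly_convex F gF mu).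

Lemma rat_row_dense (v : 'rV[R]_d) (e : R) : 0 < e ->
  exists q : 'rV[rat]_d, sqn (v - map_mx ratr q) < e.
Proof.
(* The bound by 1 gives [y^2 <= |y| < h] in each coordinate; dividing by [d.+1] rather than [d]
   makes the sum of the [d] errors strictly less than [e] and covers [d = 0]. *)
move=> e0; pose h := Num.min 1 (e / d.+1%:R).
have h0 : 0 < h by rewrite lt_min ltr01 divr_gt0.
have hq i : {q : rat | `|v 0 i - ratr q| < h}.
  apply: cid; have /rat_in_itvoo[q] : v 0 i - h < v 0 i + h.
    by rewrite ltrBlDr -addrA ltrDl addr_gt0.
  by rewrite in_itv/= => qh; exists q; rewrite distrC ltr_distl.
exists (\row_i sval (hq i)).
have : sqn (v - map_mx ratr (\row_i sval (hq i))) <= \sum_(i < d) h.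
  apply: ler_sum => i _; rewrite !mxE -expr2.
  have := svalP (hq i); set y := v 0 i - _ => yh.
  rewrite -(real_normK (num_real y)).
  have y1 : `|y| <= 1 by rewrite (le_trans (ltW yh))// ge_min lexx.
  by rewrite expr2 (le_trans (ler_piMr (normr_ge0 _) y1))// ltW.
move=> /le_lt_trans; apply.
rewrite sumr_const card_ord -mulr_natl.
have : h <= e / d.+1%:R by rewrite ge_min lexx orbT.
rewrite ler_pdivlMr ?ltr0Sn// -natr1 mulrDr mulr1 mulrC => hd.
by rewrite (lt_le_trans _ hd)// ltrDl.
Qed.

Lemma affine_le q v : F q + dotp (v - q) (gF q) <= F v.
Proof.
apply: le_trans (scF v q); rewrite lerDl.
by rewrite mulr_ge0 ?sqn_ge0// divr_ge0 ?ltW.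
Qed.

Variables (d' : measure_display) (T : measurableType d') (u : T -> 'rV[R]_d).
Hypothesis mu_coord : forall i, measurable_fun setT (fun x => u x 0 i).

Lemma measurable_dotp (v : 'rV[R]_d) : measurable_fun setT (fun x => dotp (u x) v).
Proof.
by apply: measurable_sum => i; apply: measurable_funM => //; exact: measurable_cst.
Qed.

(* [F] is the supremum of its tangents at rational points: smoothness makes the
   tangent at [q] accurate up to [L / 2 * sqn (v - q)]. *)
Lemma measurable_smooth_convex : measurable_fun setT (fun x => F (u x)).
Proof.
apply: (measurability _ (RGenOInfty.measurableE R)) => _ [_ [a ->] <-].
pose tangent (q : 'rV[rat]_d) x :=
  F (map_mx ratr q) + dotp (u x - map_mx ratr q) (gF (map_mx ratr q)).
rewrite (_ : _ `&` _ = \bigcup_q (tangent q @^-1` `]a, +oo[)).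
  apply: countable_bigcupT_measurable => [|q]; first exact: countableP.
  rewrite -[X in measurable X]setTI.
  have mt : measurable_fun setT (tangent q).
    apply: measurable_funD; first exact: measurable_cst.
    under eq_fun do rewrite dotpDl.
    by apply: measurable_funD; [exact: measurable_dotp|exact: measurable_cst].
  exact: (mt measurableT _ (measurable_itv _)).
rewrite setTI; apply/seteqP; split => [x|x [q _]] /=.
  rewrite in_itv/= andbT => aF.
  (* With this precision the tangent loses less than half of [F (u x) - a], hence stays above
     [a]. *)
  have e0 : 0 < (F (u x) - a) / L by rewrite divr_gt0// subr_gt0.
  have [q hq] := rat_row_dense (u x) e0.
  exists q => //=; rewrite in_itv/= andbT.
  have := smF (u x) (map_mx ratr q).
  move: hq; rewrite ltr_pdivlMr// /tangent mulrC => hq h.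
  have s0 := sqn_ge0 (u x - map_mx ratr q).
  have := mulr_ge0 (ltW L0) s0; lra.
rewrite !in_itv/= !andbT => /lt_le_trans; apply.
exact: affine_le.
Qed.

End smooth_convex_measurable.

Section measurable_gradient.
Variables (R : realType) (d : nat) (F : 'rV[R]_d -> R) (gF : 'rV[R]_d -> 'rV[R]_d).
Variables (L mu : R).
Hypotheses (L0 : 0 < L) (mu0 : 0 < mu).
Hypotheses (smF : Lsmooth F gF L) (scF : strongly_convex F gF mu).
Variables (d' : measure_display) (T : measurableType d') (u : T -> 'rV[R]_d).
Hypothesis mu_coord : forall i, measurable_fun setT (fun x => u x 0 i).

(** A partial derivative is the pointwise limit of the measurable difference quotients [q n]: strong
    convexity bounds them below by the derivative, smoothness above by the derivative plus [L / 2]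
    times the step. *)
Lemma measurable_gradient i : measurable_fun setT (fun x => gF (u x) 0 i).
Proof.
pose e : 'rV[R]_d := delta_mx 0 i.
have de v : dotp e v = v 0 i.
  rewrite /dotp (bigD1 i)//= big1 ?addr0 => [|j ji]; first by rewrite mxE !eqxx mul1r.
  by rewrite mxE eqxx (negbTE ji) mul0r.
have se : sqn e = 1 by rewrite sqnE de mxE !eqxx.
pose q n x := n.+1%:R * (F (u x + n.+1%:R^-1 *: e) - F (u x)).
apply: (@measurable_fun_cvg _ _ _ _ q) => [n|x _].
  apply: measurable_funM; first exact: measurable_cst.
  apply: measurable_funB; apply: (measurable_smooth_convex L0 mu0 smF scF) => // j.
  under eq_fun do rewrite mxE.
  by apply: measurable_funD => //; exact: measurable_cst.
apply: (@squeeze_cvgr _ _ _ _ (fun=> gF (u x) 0 i)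
    (fun n => gF (u x) 0 i + L / 2 * n.+1%:R^-1)).
- apply: nearW => n.
  have n0 : 0 < (n.+1%:R : R) by rewrite ltr0Sn.
  have h1 := smF (u x + n.+1%:R^-1 *: e) (u x).
  have h2 := scF (u x + n.+1%:R^-1 *: e) (u x).
  move: h1 h2; rewrite [u x + _ - u x]addrAC subrr add0r dotpZl de sqnZ se mulr1.
  rewrite /q; set f := F (_ + _); set g := gF (u x) 0 i => h1 h2.
  have n1 : n.+1%:R * n.+1%:R^-1 = 1 :> R by rewrite mulfV ?gt_eqF.
  move: n0 n1 h1 h2; move: (n.+1%:R : R) => k k0 kk h1 h2.
  have mk : 0 <= mu / 2 * k^-1 ^+ 2 by rewrite mulr_ge0 ?sqr_ge0// divr_ge0 ?ltW.
  apply/andP; split.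
    rewrite -[g]mul1r -kk -mulrA ler_pM2l//; lra.
  apply: (@le_trans _ _ (k * (k^-1 * g + L / 2 * k^-1 ^+ 2))).
    rewrite ler_pM2l//; lra.
  rewrite le_eqVlt; apply/orP; left; apply/eqP; field.
  by rewrite gt_eqF.
- exact: cvg_cst.
- rewrite -[X in _ --> X]addr0 -(mulr0 (L / 2)).
  by apply: cvgD; [exact: cvg_cst|apply: cvgMl_tmp; exact: cvg_harmonic].
Qed.

End measurable_gradient.

(** * Pathwise identities for the iterates and their means *)

Lemma scale_sum_const (R : realType) (V : lmodType R) (I : finType) n (v : V) :
  (0 < n)%N -> #|I| = n -> n%:R^-1 *: \sum_(i : I) v = v.
Proof.
move=> n0 In; rewrite sumr_const In -[v *+ n]scaler_nat scalerA mulVf ?scale1r//.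
by rewrite pnatr_eq0 -lt0n.
Qed.

Section dsw_averages.
Variables (R : realType) (d N : nat) (Omega Xi : Type).
Variables (g : 'rV[R]_d -> Xi -> 'rV[R]_d) (eta : nat -> R) (w0 : 'rV[R]_d).
Variable xi : nat -> 'I_(N * N) -> Omega -> Xi.
Hypothesis N0 : (0 < N)%N.

Local Notation w := (dsw g eta w0 xi).

Definition sample_grad t m om := g (w t m om) (xi t m om).
Definition global_mean t om := (N * N)%:R^-1 *: \sum_m w t m om.

Let N2_gt0 : (0 < N * N)%N. Proof. by rewrite muln_gt0 N0. Qed.
Let N2_neq0 : (N * N)%:R != 0 :> R. Proof. by rewrite pnatr_eq0 -lt0n. Qed.
Let N_neq0 : N%:R != 0 :> R. Proof. by rewrite pnatr_eq0 -lt0n. Qed.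

Lemma dsw_const t m m' om : same_block t m m' -> w t.+1 m om = w t.+1 m' om.
Proof.
by move=> mm' /=; congr (_ *: _); apply: eq_bigl => j; exact: same_block_eq.
Qed.

Lemma global_mean0 om : global_mean 0 om = w0.
Proof.
by rewrite /global_mean /= scale_sum_const ?card_ord.
Qed.

(** All workers agree at time 0. Later the iterates are constant on the blocks of the previous
    partition, so [sum_cross_block] applies. *)
Lemma block_mean_dsw t m0 om :
  N%:R^-1 *: \sum_(k | same_block t k m0) w t k om = global_mean t om.
Proof.
case: t => [|t].
  have [a [b ->]] := workerP N0 0 m0.
  by rewrite sum_block// global_mean0 /= scale_sum_const ?card_ord.
rewrite /global_mean -(sum_cross_block N0 m0 (fun m m' => @dsw_const t m m' om)).
by rewrite -[X in _ = _ *: X]scaler_nat scalerA natrM invfM -mulrA mulVf// mulr1.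
Qed.

(** Since block means of iterates equal the global mean, one synchronisation erases all earlier
    disagreement; only the gradients still depend on the block. *)
Lemma dswS t m om : w t.+1 m om =
  global_mean t om - eta t *: (N%:R^-1 *: \sum_(j | same_block t j m) sample_grad t j om).
Proof.
rewrite /= sumrB scalerBr block_mean_dsw -scaler_sumr scalerA mulrC -scalerA.
by [].
Qed.

Lemma global_meanS t om : global_mean t.+1 om =
  global_mean t om - eta t *: ((N * N)%:R^-1 *: \sum_m sample_grad t m om).
Proof.
rewrite {1}/global_mean; under eq_bigr do rewrite dswS.
rewrite sumrB scalerBr scale_sum_const ?card_ord//.
congr (_ - _); rewrite -scaler_sumr -scaler_sumr sum_blocks//.
rewrite -[X in _ *: (_ *: (_ *: X))]scaler_nat !scalerA; congr (_ *: _).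
by rewrite -mulrA mulVf// mulr1 mulrC.
Qed.

(** The spread about the mean is at most the second moment about the previous mean, where [dswS]
    leaves just block averages of gradients. Jensen in each block and [sum_blocks] conclude. *)
Lemma dsw_divergence t om :
  (N * N)%:R^-1 * \sum_m sqn (w t.+1 m om - global_mean t.+1 om) <=
  eta t ^+ 2 * ((N * N)%:R^-1 * \sum_m sqn (sample_grad t m om)).
Proof.
pose f m := w t.+1 m om - global_mean t om.
have N2 : #|predT : pred 'I_(N * N)| = (N * N)%N by rewrite card_ord.
have fE m : w t.+1 m om - global_mean t.+1 om =
    f m - (N * N)%:R^-1 *: \sum_m f m.
  rewrite /f sumrB scalerBr scale_sum_const ?card_ord//.
  by rewrite opprB addrA subrK.
under eq_bigr do rewrite fE.
rewrite (sqn_mean f N2_gt0 N2).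
apply: (@le_trans _ _ ((N * N)%:R^-1 * \sum_m sqn (f m))).
  by rewrite gerBl sqn_ge0.
rewrite mulrCA ler_pM2l ?invr_gt0 ?ltr0n//.
apply: (@le_trans _ _ (\sum_m eta t ^+ 2 *
    (N%:R^-1 * \sum_(j | same_block t j m) sqn (sample_grad t j om)))).
  apply: ler_sum => m _; rewrite /f dswS addrAC subrr add0r sqnN sqnZ.
  rewrite ler_wpM2l ?sqr_ge0//.
  by apply: sqn_mean_le => //; exact: card_block.
rewrite -mulr_sumr -mulr_sumr sum_blocks//.
by rewrite -[X in _ * (_ * X)]mulr_natl (mulrA N%:R^-1) mulVf// mul1r.
Qed.

End dsw_averages.

(** * Solution of the scalar recursion *)

(* With [eta_t = 2 / (mu x)], [x = gamma + t], the recursion reads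
   [Delta' <= (1 - 2 / x) Delta + B (2 / (mu x))^2]. *)
Lemma sgd_rate (R : realType) (L mu G B : R) (Delta D : nat -> R) :
  0 < L -> 0 < mu -> 8 * G ^+ 2 <= B ->
  let gamma := Num.max (8 * (L / mu)) 2 in
  let eta := fun t : nat => 2 / (mu * (gamma + t%:R)) in
  (forall t, 0 <= Delta t) -> D 0%N <= 0 ->
  (forall t, D t.+1 <= eta t ^+ 2 * G ^+ 2) ->
  (forall t, Delta t.+1 <= Delta t - 2 * eta t * (mu * Delta t - L / 2 * D t)
                           + eta t ^+ 2 * G ^+ 2) ->
  forall t, (gamma + t%:R) * Delta t <= 4 * B / mu ^+ 2 + gamma * Delta 0%N.
Proof.
move=> L0 mu0 GB gamma eta Delta0 D0 DS DeltaS.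
have gamma2 : 2 <= gamma by rewrite le_max lexx orbT.
have gammaL : 8 * (L / mu) <= gamma by rewrite le_max lexx.
have G0 := sqr_ge0 G.
have x2 t : 2 <= gamma + t%:R by rewrite (le_trans gamma2)// lerDl.
have x0 t : 0 < gamma + t%:R by rewrite (lt_le_trans _ (x2 t)).
have eta0 t : 0 < eta t by rewrite divr_gt0// mulr_gt0.
have etamu t : eta t * mu = 2 / (gamma + t%:R).
  by rewrite /eta; field; rewrite !gt_eqF.
have etaL t : eta t * L <= 4^-1.
  have -> : eta t * L = 4^-1 * (8 * (L / mu) / (gamma + t%:R)).
    by rewrite /eta; field; rewrite !gt_eqF.
  rewrite ler_piMr ?invr_ge0// ler_pdivrMr// mul1r (le_trans gammaL)// lerDl//.
(* Consecutive step sizes satisfy [eta t <= 3 / 2 * eta t.+1], because [(x + 1) / x <= 3 / 2] for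
   [x >= 2]; squaring gives 9/4. *)
have DG t : D t <= 9 / 4 * eta t ^+ 2 * G ^+ 2.
  case: t => [|t].
    by rewrite (le_trans D0)// mulr_ge0// mulr_ge0 ?sqr_ge0 ?divr_ge0.
  apply: (le_trans (DS t)); rewrite ler_wpM2r//.
  have -> : 9 / 4 * eta t.+1 ^+ 2 = (3 / 2 * eta t.+1) ^+ 2 by field.
  rewrite ler_sqr ?nnegrE ?(ltW (eta0 _))//; last first.
    by rewrite mulr_ge0// ltW.
  have -> : eta t = (2 / mu) * (gamma + t%:R)^-1.
    by rewrite /eta; field; rewrite !gt_eqF.
  have -> : 3 / 2 * eta t.+1 = (2 / mu) * (3 / (2 * (gamma + t.+1%:R))).
    by rewrite /eta; move: (gamma + _) (x0 t.+1) => y y0; field; rewrite !gt_eqF.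
  rewrite ler_pM2l ?divr_gt0// ler_pdivlMr ?mulr_gt0// mulrC ler_pdivrMr//.
  have := x2 t; rewrite -natr1; lra.
(* One of the two copies of [eta t * mu * Delta t] is given up. The divergence costs [9 / 16] and
   the noise 1, in units of [eta t ^+ 2 * G ^+ 2], well within the 8 allowed by [B]. *)
have step t : Delta t.+1 <= (1 - 2 / (gamma + t%:R)) * Delta t + eta t ^+ 2 * B.
  apply: (le_trans (DeltaS t)).
  have e2 := sqr_ge0 (eta t).
  have h1 : eta t * L * D t <= 9 / 16 * (eta t ^+ 2 * G ^+ 2).
    (* Multiplying [etaL] by [D t] requires a sign, which is not among the assumptions on [D]. *)
    have [Dt0|Dt0] := leP (D t) 0.
      rewrite (@le_trans _ _ 0)//; last first.
        by rewrite mulr_ge0 ?divr_ge0// mulr_ge0.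
      by rewrite mulr_ge0_le0// ltW// mulr_gt0.
    apply: (le_trans (ler_wpM2r (ltW Dt0) (etaL t))).
    have := DG t; lra.
  have h2 : eta t ^+ 2 * (8 * G ^+ 2) <= eta t ^+ 2 * B by rewrite ler_wpM2l.
  have h3 : 0 <= eta t * mu * Delta t.
    by apply: mulr_ge0 => //; apply: mulr_ge0; exact: ltW.
  have h4 : 0 <= eta t ^+ 2 * G ^+ 2 by rewrite mulr_ge0.
  rewrite mulrBl -etamu; lra.
have B0 : 0 <= B by rewrite (le_trans _ GB)// mulr_ge0.
elim=> [|t IH].
  by rewrite addr0 lerDr divr_ge0 ?sqr_ge0// mulr_ge0.
set V := _ + gamma * Delta 0%N in IH *.
have BV : 4 * B / mu ^+ 2 <= V by rewrite lerDl mulr_ge0// (le_trans _ gamma2).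
have V0 : 0 <= V by rewrite (le_trans _ BV)// divr_ge0 ?sqr_ge0// mulr_ge0.
have := x2 t; have := x0 t; have := step t.
have -> : eta t ^+ 2 * B = (4 * B / mu ^+ 2) / (gamma + t%:R) ^+ 2.
  by rewrite /eta; field; rewrite !gt_eqF.
rewrite -[t.+1%:R]natr1 addrA; move: (gamma + t%:R) IH => x IH st xp xge2.
(* The induction hypothesis contributes [(x - 2) * V] and the noise at most [V]. As
   [(x - 1) * (x + 1) <= x ^+ 2], dividing by [x - 1] then yields the claim at [x + 1]. *)
have st1 : x ^+ 2 * Delta t.+1 <= (x - 1) * V.
  have : x ^+ 2 * Delta t.+1 <= (x - 2) * (x * Delta t) + 4 * B / mu ^+ 2.
    apply: (le_trans (ler_wpM2l (sqr_ge0 x) st)).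
    rewrite le_eqVlt; apply/orP; left; apply/eqP; field.
    by rewrite !gt_eqF.
  have : (x - 2) * (x * Delta t) <= (x - 2) * V by rewrite ler_wpM2l// subr_ge0.
  lra.
have xm : 0 < x - 1 by rewrite subr_gt0 (lt_le_trans _ xge2)// ltr1n.
rewrite -(ler_pM2l xm) mulrA.
apply: le_trans st1.
have := Delta0 t.+1; nra.
Qed.

(** * Expectations along the algorithm *)

Lemma rowB_coord (V : zmodType) n (u v : 'rV[V]_n) i : (u - v) 0 i = u 0 i - v 0 i.
Proof. by rewrite !mxE. Qed.

Section vector_L2.
Context d' (T : measurableType d') (R : realType) (P : probability T R) (d : nat).
Implicit Types u v : T -> 'rV[R]_d.

Lemma L1_dotp u v : (forall i, L2 P (fun x => u x 0 i)) ->
  (forall i, L2 P (fun x => v x 0 i)) -> L1 P (fun x => dotp (u x) (v x)).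
Proof. by move=> u2 v2; apply: L1_sum => i; exact: L2_mul. Qed.

Lemma L1_sqn u : (forall i, L2 P (fun x => u x 0 i)) -> L1 P (fun x => sqn (u x)).
Proof. by move=> u2; exact: L1_dotp. Qed.

End vector_L2.

Section dsw_probability.
Variables (R : realType) (d N : nat) (d1 d2 : measure_display).
Variables (Omega : measurableType d1) (Xi : measurableType d2).
Variables (P : probability Omega R).
Variables (F : 'rV[R]_d -> R) (gF : 'rV[R]_d -> 'rV[R]_d).
Variables (g : 'rV[R]_d -> Xi -> 'rV[R]_d) (eta : nat -> R).
Variable xi : nat -> 'I_(N * N) -> Omega -> Xi.
Variables (w0 wstar : 'rV[R]_d) (L mu G : R).
Hypotheses (N0 : (0 < N)%N) (L0 : 0 < L) (mu0 : 0 < mu).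
Hypotheses (smF : Lsmooth F gF L) (scF : strongly_convex F gF mu).
Hypothesis minF : forall w, F wstar <= F w.
Hypothesis mxi : forall t m, measurable_fun setT (xi t m).

Local Notation w := (dsw g eta w0 xi).
Local Notation gs := (sample_grad g eta w0 xi).
Local Notation wh := (global_mean g eta w0 xi).

Hypothesis mgs : forall t m (i : 'I_d) (B : set R), measurable B ->
  filt xi t.+1 ((fun om => gs t m om 0 i) @^-1` B).
Hypothesis unbiased : forall t m (i : 'I_d),
  P.-integrable setT (EFin \o (fun om => gs t m om 0 i)) /\
  forall A, filt xi t A ->
    (\int[P]_(om in A) (gs t m om 0 i)%:E
     = \int[P]_(om in A) (gF (w t m om) 0 i)%:E)%E.
Hypothesis bounded : forall t m, ('E_P[fun om => sqn (gs t m om)] <= (G ^+ 2)%:E)%E.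

(** The generators of [filt xi t], named so that this sigma-algebra can serve as a measurable type
    via [filtT]. *)
Definition cylinders t : set (set Omega) :=
  [set B | exists (s : nat) (m : 'I_(N * N)) (A : set Xi),
     (s < t)%N /\ measurable A /\ B = xi s m @^-1` A].

Lemma filt_measurable t : <<s cylinders t >> `<=` measurable.
Proof.
apply: smallest_sub; first exact: sigma_algebra_measurable.
move=> _ [s [m [A [_ [mA ->]]]]].
by rewrite -[X in measurable X]setTI; exact: mxi.
Qed.

Lemma filtS t : <<s cylinders t >> `<=` <<s cylinders t.+1 >>.
Proof.
apply: sub_sigma_algebra2 => _ [s [m [A [st [mA ->]]]]].
by exists s, m, A; split; [exact: leqW|].
Qed.

Local Notation filtT t := (g_sigma_algebraType (cylinders t)).

Lemma measurable_filt t (X : Omega -> R) :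
  measurable_fun setT (X : filtT t -> R) -> measurable_fun setT X.
Proof. by move=> mX _ B mB; apply: (@filt_measurable t); exact: mX. Qed.

Lemma measurable_filtS t (X : Omega -> R) :
  measurable_fun setT (X : filtT t -> R) -> measurable_fun setT (X : filtT t.+1 -> R).
Proof. by move=> mX _ B mB; apply: (@filtS t); exact: mX. Qed.

Lemma measurable_gs t m i :
  measurable_fun setT ((fun om => gs t m om 0 i) : filtT t.+1 -> R).
Proof. by move=> _ B mB; rewrite setTI; exact: mgs. Qed.

(** The iterate at [t.+1] involves samples up to time [t] only. Measurability for [filtT t], not
    just for the ambient space, is what the conditioning argument requires. *)
Lemma measurable_w t m i :
  measurable_fun setT ((fun om => w t m om 0 i) : filtT t -> R).
Proof.
elim: t m => [|t IH] m; first exact: measurable_cst.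
rewrite /=; under eq_fun do rewrite mxE summxE.
apply: measurable_funM; first exact: measurable_cst.
under eq_fun do rewrite big_mkcond.
apply: measurable_sum => j; case: (same_block t j m); last exact: measurable_cst.
under eq_fun do rewrite !mxE.
apply: measurable_funB; first exact: (@measurable_filtS t).
by apply: measurable_funM; [exact: measurable_cst|exact: measurable_gs].
Qed.

Lemma L1_sqn_gs t m : L1 P (fun om => sqn (gs t m om)).
Proof.
have mg i : measurable_fun setT (fun om => gs t m om 0 i).
  exact: (measurable_filt (@measurable_gs t m i)).
have ms : measurable_fun setT (fun om => sqn (gs t m om)).
  by apply: measurable_sum => i; exact: measurable_funM.
apply/integrableP; split; first exact/measurable_EFinP.
have := bounded t m; rewrite unlock => h.
under eq_integral do rewrite /= ger0_norm ?sqn_ge0//.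
by rewrite (le_lt_trans h)// ltry.
Qed.

Lemma L2_gs t m i : L2 P (fun om => gs t m om 0 i).
Proof.
apply: le_L2 (L1_sqn_gs t m) _ => [|om]; last exact: sqr_coord_le.
exact: (measurable_filt (@measurable_gs t m i)).
Qed.

Lemma L2_w t m i : L2 P (fun om => w t m om 0 i).
Proof.
elim: t m => [|t IH] m; first exact: L2_cst.
rewrite /=; under eq_fun do rewrite mxE summxE.
apply: L2Z; apply: L2_sum => j; under eq_fun do rewrite !mxE.
by apply: L2B => //; apply: L2Z; exact: L2_gs.
Qed.

Lemma L2_wh t i : L2 P (fun om => wh t om 0 i).
Proof.
rewrite /global_mean; under eq_fun do rewrite mxE summxE.
by apply: L2Z; apply: L2_sum => j; exact: L2_w.
Qed.

Lemma L2_whB t v i : L2 P (fun om => (wh t om - v) 0 i).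
Proof.
by under eq_fun do rewrite rowB_coord; apply: L2B; [exact: L2_wh|exact: L2_cst].
Qed.

Lemma measurable_wh t i :
  measurable_fun setT ((fun om => wh t om 0 i) : filtT t -> R).
Proof.
rewrite /global_mean; under eq_fun do rewrite mxE summxE.
apply: measurable_funM; first exact: measurable_cst.
by apply: measurable_sum => j; exact: measurable_w.
Qed.

Lemma measurable_gFw t m i :
  measurable_fun setT ((fun om => gF (w t m om) 0 i) : filtT t -> R).
Proof.
by apply: (measurable_gradient L0 mu0 smF scF) => j; exact: measurable_w.
Qed.

Lemma L2_gFw t m i : L2 P (fun om => gF (w t m om) 0 i).
Proof.
apply: (@le_L2 _ _ _ _ _ (fun om => L ^+ 2 * sqn (w t m om - wstar))) => [||om].
- exact: (measurable_filt (@measurable_gFw t m i)).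
- apply/L1Z/L1_sqn => j; under eq_fun do rewrite rowB_coord.
  by apply: L2B; [exact: L2_w|exact: L2_cst].
- apply: le_trans (sqr_coord_le _ _) _.
  exact: (sqn_grad_le_dist L0 smF minF).
Qed.

(** In each coordinate [wh t om - wstar] is known at time [t], while the gradient error integrates
    to zero over every event of [filt xi t]; [Rintegral_mul0] applies. *)
Lemma Rintegral_dotp_unbiased t m :
  \int[P]_om dotp (wh t om - wstar) (gs t m om) =
  \int[P]_om dotp (wh t om - wstar) (gF (w t m om)).
Proof.
rewrite /dotp !Rintegral_sum; last first.
- by move=> i; apply: L2_mul; [exact: L2_whB|exact: L2_gs].
- by move=> i; apply: L2_mul; [exact: L2_whB|exact: L2_gFw].
apply: eq_bigr => i _.
have Xg := L2_mul (L2_whB t wstar i) (L2_gs t m i).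
have XgF := L2_mul (L2_whB t wstar i) (L2_gFw t m i).
apply/eqP; rewrite -subr_eq0 -RintegralB//; apply/eqP.
under eq_Rintegral do rewrite -mulrBr.
have mX : measurable_fun setT ((fun om => (wh t om - wstar) 0 i) : filtT t -> R).
  under eq_fun do rewrite rowB_coord.
  by apply: measurable_funB; [exact: measurable_wh|exact: measurable_cst].
have g1 := L2_L1 (L2_gs t m i); have gF1 := L2_L1 (L2_gFw t m i).
apply: (Rintegral_mul0 (@filt_measurable t) mX).
- exact: measurable_filt mX.
- exact: L1B.
- by under eq_fun do rewrite mulrBr; exact: L1B.
move=> A fA; have mA := filt_measurable fA.
have ig := integrableS measurableT mA (@subsetT _ A) g1.
have igF := integrableS measurableT mA (@subsetT _ A) gF1.
rewrite integralB_EFin//; have [_ /(_ A fA) ->] := unbiased t m i.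
by rewrite subee// integrable_fin_num.
Qed.

Let N2_gt0 : (0 < N * N)%N. Proof. by rewrite muln_gt0 N0. Qed.

Definition dist2 t := \int[P]_om sqn (wh t om - wstar).
Definition divergence t :=
  \int[P]_om ((N * N)%:R^-1 * \sum_m sqn (w t m om - wh t om)).

Lemma mean_const (a : R) : (N * N)%:R^-1 * (\sum_(m < N * N) a) = a.
Proof. exact: (@scale_sum_const R R^o _ _ a N2_gt0 (card_ord _)). Qed.

Lemma L1_mean (f : 'I_(N * N) -> Omega -> R) : (forall m, L1 P (f m)) ->
  L1 P (fun om => (N * N)%:R^-1 * \sum_m f m om).
Proof. by move=> f1; apply/L1Z/L1_sum. Qed.

Lemma Rintegral_mean (f : 'I_(N * N) -> Omega -> R) : (forall m, L1 P (f m)) ->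
  \int[P]_om ((N * N)%:R^-1 * \sum_m f m om) =
  (N * N)%:R^-1 * \sum_m \int[P]_om f m om.
Proof. by move=> f1; rewrite RintegralZl ?Rintegral_sum//; exact: L1_sum. Qed.

Lemma mean_gs_le t : \int[P]_om ((N * N)%:R^-1 * \sum_m sqn (gs t m om)) <= G ^+ 2.
Proof.
rewrite Rintegral_mean; last by move=> m; exact: L1_sqn_gs.
rewrite -[leRHS]mean_const ler_pM2l ?invr_gt0 ?ltr0n//.
apply: ler_sum => m _; rewrite -lee_fin fineK.
  by have := bounded t m; rewrite unlock.
by apply: integrable_fin_num => //; exact: L1_sqn_gs.
Qed.

Lemma divergence0 : divergence 0 = 0.
Proof.
rewrite /divergence; under eq_Rintegral do rewrite global_mean0//= subrr sqn0 mean_const.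
by rewrite Rintegral_cst// mul0r.
Qed.

Lemma L1_divergence t :
  L1 P (fun om => (N * N)%:R^-1 * \sum_m sqn (w t m om - wh t om)).
Proof.
apply: L1_mean => m; apply: L1_sqn => i; under eq_fun do rewrite rowB_coord.
by apply: L2B; [exact: L2_w|exact: L2_wh].
Qed.

Lemma divergenceS t : divergence t.+1 <= eta t ^+ 2 * G ^+ 2.
Proof.
have g1 := L1_mean (L1_sqn_gs t).
apply: (@le_trans _ _ (\int[P]_om (eta t ^+ 2 *
    ((N * N)%:R^-1 * \sum_m sqn (gs t m om))))).
  apply: le_Rintegral => //; first exact: L1_divergence.
    exact: L1Z.
  by move=> om _; exact: dsw_divergence.
by rewrite RintegralZl// ler_wpM2l ?sqr_ge0// mean_gs_le.
Qed.

Lemma L1_dist2 t : L1 P (fun om => sqn (wh t om - wstar)).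
Proof. by apply: L1_sqn => i; exact: L2_whB. Qed.

Lemma dist2_ge0 t : 0 <= dist2 t.
Proof. by apply: Rintegral_ge0 => om _; exact: sqn_ge0. Qed.

Lemma dist20 : dist2 0 = sqn (w0 - wstar).
Proof.
rewrite /dist2; under eq_Rintegral do rewrite global_mean0//.
rewrite Rintegral_cst// -[RHS]mulr1; congr (_ * _).
by rewrite -[1]/(fine 1%E) -(probability_setT P).
Qed.

Hypothesis eta0 : forall t, 0 < eta t.

(** Expand the square of [wh t - wstar] minus the averaged step. The cross term is [descent]; Jensen
    and the second moment bound control the quadratic term. *)
Lemma dist2S t : dist2 t.+1 <=
  dist2 t - 2 * eta t * (mu * dist2 t - L / 2 * divergence t) + eta t ^+ 2 * G ^+ 2.
Proof.
pose I f := (N * N)%:R^-1 * \sum_(m < N * N) (f m : R).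
pose X om := wh t om - wstar.
have X2 i : L2 P (fun om => X om 0 i) by exact: L2_whB.
have Xg1 m : L1 P (fun om => dotp (X om) (gs t m om)).
  by apply: L1_dotp => // i; exact: L2_gs.
have XgF1 m : L1 P (fun om => dotp (X om) (gF (w t m om))).
  by apply: L1_dotp => // i; exact: L2_gFw.
have g1 := L1_mean (L1_sqn_gs t).
have Xg := L1_mean Xg1; have XgF := L1_mean XgF1.
have X1 := L1_dist2 t; have D1 := L1_divergence t.
(* Stochastic gradients are first exchanged for true ones under the integral, since convexity gives
   a pathwise bound only for the latter. *)
have descent : mu * dist2 t - L / 2 * divergence t <=
    \int[P]_om I (fun m => dotp (X om) (gs t m om)).
  rewrite Rintegral_mean// (eq_bigr _ (fun m _ => Rintegral_dotp_unbiased t m)).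
  rewrite -Rintegral_mean// /dist2 /divergence -!RintegralZl// -RintegralB//; last first.
  - exact: L1Z.
  - exact: L1Z.
  apply: le_Rintegral => //; first by apply: L1B; exact: L1Z.
  move=> om _; apply: (dotp_mean_grad_ge L0 mu0 smF scF minF N2_gt0) => //.
  exact: card_ord.
apply: (@le_trans _ _ (\int[P]_om (sqn (X om)
    - 2 * eta t * I (fun m => dotp (X om) (gs t m om))
    + eta t ^+ 2 * I (fun m => sqn (gs t m om))))).
  apply: le_Rintegral => //; first exact: L1_dist2.
    by apply: L1D; [apply: L1B => //; exact: L1Z|exact: L1Z].
  move=> om _; rewrite global_meanS// addrAC sqnB -/(X om) dotpZr dotpZr dotp_sumr sqnZ.
  rewrite mulrA lerD2l ler_wpM2l ?sqr_ge0//.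
  by apply: sqn_mean_le => //; exact: card_ord.
rewrite RintegralD//; last first.
- exact: L1Z.
- by apply: L1B => //; exact: L1Z.
rewrite RintegralB//; last exact: L1Z.
rewrite (RintegralZl _ measurableT Xg) (RintegralZl _ measurableT g1).
apply: lerD; last by rewrite ler_wpM2l ?sqr_ge0// mean_gs_le.
by rewrite lerB// ler_wpM2l// mulr_ge0// ltW.
Qed.

Lemma expectation_F_le t :
  ('E_P[fun om => F (wh t om)] - (F wstar)%:E <= (L / 2 * dist2 t)%:E)%E.
Proof.
have mF : measurable_fun setT (fun om => F (wh t om)).
  apply: (measurable_smooth_convex L0 mu0 smF scF) => i.
  exact: measurable_filt (@measurable_wh t i).
have X1 := L1Z (L / 2) (L1_dist2 t).
(* [F] lies between [F wstar] and [F wstar] plus a quadratic, which gives an integrable dominating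
   function. *)
have F1 : L1 P (fun om => F (wh t om)).
  have c1 := L1_cst P `|F wstar|.
  apply: le_L1 mF (L1D X1 c1) _ => om.
  have := F_upper L0 smF minF (wh t om); have := minF (wh t om).
  have := ler_norm (F wstar); have := ler_norm (- F wstar); rewrite normrN.
  move=> *; rewrite ler_norml; apply/andP; split; lra.
rewrite unlock -[X in (X - _)%E]fineK; last exact: integrable_fin_num.
rewrite -EFinB lee_fin -/(Rintegral P setT (fun om => F (wh t om))).
have cst1 : F wstar = \int[P]_om (fun=> F wstar) om.
  rewrite Rintegral_cst// -[LHS]mulr1; congr (_ * _).
  by rewrite -[1]/(fine 1%E) -(probability_setT P).
rewrite [X in _ - X]cst1 -RintegralB//; last exact: L1_cst.
rewrite /dist2 -RintegralZl//; last exact: L1_dist2.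
apply: le_Rintegral => //; first by apply: L1B => //; exact: L1_cst.
by move=> om _; exact: (F_upper L0 smF minF).
Qed.

End dsw_probability.

(** * From the distance rate to the bound on the objective gap *)

Theorem theoremA4 (R : realType) (d N : nat) (d1 d2 : measure_display)
  (Omega : measurableType d1) (Xi : measurableType d2) (P : probability Omega R)
  (F : 'rV[R]_d -> R) (gF : 'rV[R]_d -> 'rV[R]_d)
  (g : 'rV[R]_d -> Xi -> 'rV[R]_d)
  (xi : nat -> 'I_(N * N) -> Omega -> Xi)
  (w0 wstar : 'rV[R]_d) (L mu sigma G : R) :
  (0 < N)%N -> 0 < L -> 0 < mu ->
  has_gradient F gF ->
  Lsmooth F gF L ->
  strongly_convex F gF mu ->
  (forall w, F wstar <= F w) ->
  (forall t m, measurable_fun setT (xi t m)) ->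
  let kappa := L / mu in
  let gamma := Num.max (8 * kappa) 2 in
  let eta := fun t : nat => 2 / (mu * (gamma + t%:R)) in
  let w := dsw g eta w0 xi in
  (* the sampled stochastic gradients are random vectors, F_{t+1}-measurable *)
  (forall t m (i : 'I_d) (B : set R), measurable B ->
     filt xi t.+1 ((fun om => g (w t m om) (xi t m om) 0 i) @^-1` B)) ->
  (* conditionally on F_t, the xi_t^m are independent across m *)
  (forall t, cond_indep P (filt xi t) (xi t)) ->
  (* E[grad F(w_t^m, xi_t^m) | F_t] = grad F(w_t^m), coordinatewise *)
  (forall t m (i : 'I_d),
     P.-integrable setT (EFin \o (fun om => g (w t m om) (xi t m om) 0 i)) /\
     forall A, filt xi t A ->
       (\int[P]_(om in A) (g (w t m om) (xi t m om) 0 i)%:E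
        = \int[P]_(om in A) (gF (w t m om) 0 i)%:E)%E) ->
  (* (iii) bounded variance *)
  (forall t m,
     ('E_P[fun om => sqn (g (w t m om) (xi t m om) - gF (w t m om))]
      <= (sigma ^+ 2)%:E)%E) ->
  (* (iv) bounded second moment *)
  (forall t m,
     ('E_P[fun om => sqn (g (w t m om) (xi t m om))] <= (G ^+ 2)%:E)%E) ->
  forall (t : nat) (m0 : 'I_(N * N)),
    let wbar := fun om =>
      (N%:R)^-1 *: \sum_(k : 'I_(N * N) | @same_block N t k m0) w t k om in
    let B := sigma ^+ 2 / N%:R + 8 * G ^+ 2 in
    ('E_P[fun om => F (wbar om)] - (F wstar)%:E
     <= (2 * kappa / (gamma + t%:R)
         * (B / mu + 2 * L * sqn (w0 - wstar)))%:E)%E.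
Proof.
move=> N0 L0 mu0 _ smF scF minF mxi kappa gamma eta w mgs _ unbiased _ bounded t m0.
cbv zeta; set B := sigma ^+ 2 / N%:R + 8 * G ^+ 2.
have gamma0 : 0 < gamma by rewrite lt_max ltr0Sn orbT.
have x0 s : 0 < gamma + s%:R by rewrite (lt_le_trans gamma0)// lerDl.
have eta0 s : 0 < eta s by rewrite divr_gt0// mulr_gt0.
rewrite (_ : (fun om => F _) = (fun om => F (global_mean g eta w0 xi t om))); last first.
  by apply/funext => om; rewrite block_mean_dsw.
have GB : 8 * G ^+ 2 <= B by rewrite lerDr divr_ge0// sqr_ge0.
apply: (le_trans (expectation_F_le L0 mu0 smF scF minF mxi mgs bounded t)).
rewrite lee_fin.
pose Delta := dist2 P g eta xi w0 wstar.
have rate : (gamma + t%:R) * Delta t <= 4 * B / mu ^+ 2 + gamma * Delta 0%N.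
  apply: (sgd_rate L0 mu0 GB (D := divergence P g eta xi w0)).
  - exact: dist2_ge0.
  - by rewrite divergence0.
  - exact: (divergenceS N0 mxi mgs bounded).
  - exact: (dist2S N0 L0 mu0 smF scF minF mxi mgs unbiased bounded eta0).
(* The initial term must carry the factor [8 * kappa] rather than [gamma]: multiplied by [L / 2] it
   becomes [2 * kappa * (2 * L)], as in the claim. *)
rewrite /Delta dist20// /gamma (max_kappa_sqn L0 mu0 smF scF minF) -/gamma in rate.
have -> : 2 * kappa / (gamma + t%:R) * (B / mu + 2 * L * sqn (w0 - wstar)) =
    L / 2 * ((gamma + t%:R)^-1 *
      (4 * B / mu ^+ 2 + 8 * (L / mu) * sqn (w0 - wstar))).
  by rewrite /kappa; field; rewrite !gt_eqF.
by rewrite ler_pM2l ?divr_gt0// -ler_pdivrMl ?invr_gt0// invrK.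
Qed.
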